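(* Let $G=(V,E)$ be a finite connected undirected graph with $n=|V|$ vertices and let $r\ge 1$ be an integer. Suppose that the automorphism group of $G$ acts transitively on $V$ and that $G$ contains a diameter perfect code (for the parameter $r$), i.e. a code $C\subseteq V$ with minimum distance at least $r+1$ and $|C|\cdot D_G(r)=n$. Then $$\mathsf{cap}(G_r)=1-\frac{1}{D_G(r)},$$ where $D_G(r)$ is the largest possible size of an anticode in $G$ of diameter $r$.
   Context: Let $\rho(u,v)$ be the length of a shortest path between $u$ and $v$ in $G$. A code in $G$ is a subset $C\subseteq V$; it has minimum distance at least $d$ if $\rho(u,v)\ge d$ for all distinct $u,v\in C$. An anticode of diameter $r$ is a subset $D\subseteq V$ with $\rho(u,v)\le r$ for all $u,v\in D$. The graph $G_r$ has vertex set $V$, with $u,v$ adjacent if and only if $1\le\rho(u,v)\le r$. Storage codes and capacity: for a finite graph $H=(V,E_H)$ with $|V|=n$ and a finite alphabet $Q$ of size $q\ge 2$, a storage code on $H$ over $Q$ is a nonempty set $\mathcal C\subseteq Q^V$ such that for each $v\in V$ there is a function $f_v$ with $x_v=f_v((x_u)_{u\in N(v)})$ for all $x\in\mathcal C$, where $N(v)=\{u:(v,u)\in E_H\}$. Its rate is $\mathcal R_q(\mathcal C)=\frac1n\log_q|\mathcal C|$. The capacity $\mathsf{cap}(H)$ is the supremum of $\mathcal R_q(\mathcal C)$ over all $q\ge 2$ and all storage codes $\mathcal C$ on $H$ over alphabets of size $q$. *)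

(* Defs.v *)
From HB Require Import structures.
From mathcomp Require Import all_boot all_order all_algebra all_fingroup.
From mathcomp Require Import boolp classical_sets reals topology normedtype.
From mathcomp Require Import sequences exp.

Set Implicit Arguments.
Unset Strict Implicit.
Unset Printing Implicit Defensive.

Import Order.TTheory GRing.Theory Num.Theory.

Definition simple_graph (V : finType) (e : rel V) : Prop :=
  symmetric e /\ irreflexive e.

Definition connected_graph (V : finType) (e : rel V) : Prop :=
  0 < #|V| /\ forall u v : V, connect e u v.

Definition is_graph_aut (V : finType) (e : rel V) (s : {perm V}) : bool :=
  [forall u, forall v, e (s u) (s v) == e u v].

Definition graph_aut (V : finType) (e : rel V) : {set {perm V}} :=
  [set s | is_graph_aut e s].

Lemma graph_aut_group_set (V : finType) (e : rel V) :
  group_set (graph_aut e).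
Proof.
apply/group_setP; split=> [|s t].
  by rewrite inE; apply/forallP=> u; apply/forallP=> v; rewrite !perm1.
rewrite !inE => /forallP sP /forallP tP.
apply/forallP=> u; apply/forallP=> v; rewrite !permM.
by rewrite (eqP (forallP (tP _) _)) (eqP (forallP (sP _) _)).
Qed.

Canonical graph_aut_group (V : finType) (e : rel V) :=
  Group (graph_aut_group_set e).

Definition vertex_transitive (V : finType) (e : rel V) : Prop :=
  [transitive graph_aut e, on [set: V] | 'P]%act.

Definition has_walk (V : finType) (e : rel V) (u v : V) (k : nat) : bool :=
  [exists p : k.-tuple V, path e u p && (last u p == v)].

(* A shortest path has length < #|V|, so it suffices to search these lengths;
   the value is #|V| when v is not reachable from u. *)
Definition gdist (V : finType) (e : rel V) (u v : V) : nat :=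
  find (has_walk e u v) (iota 0 #|V|).

Lemma gdistP (V : finType) (e : rel V) (u v : V) : connect e u v ->
  has_walk e u v (gdist e u v) /\
  forall k, has_walk e u v k -> gdist e u v <= k.
Proof.
move=> /connectP [p0 p0P vE]; subst v.
have [p pP up _] := shortenP p0P; set v := last u p.
have ltp : size p < #|V| by rewrite -[(size p).+1]/(size (u :: p)) -(card_uniqP up) max_card.
have wp : has_walk e u v (size p).
  by apply/existsP; exists (in_tuple p); rewrite pP eqxx.
have hs : has (has_walk e u v) (iota 0 #|V|).
  by apply/hasP; exists (size p); rewrite ?mem_iota.
have lt := hs; rewrite has_find size_iota in lt.
split; first by have := nth_find 0 hs; rewrite nth_iota.
move=> k wk; rewrite leqNgt; apply/negP=> kl.
have := before_find 0 kl; rewrite nth_iota ?add0n ?wk //.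
exact: ltn_trans kl lt.
Qed.

Definition min_dist_geq (V : finType) (e : rel V) (d : nat) (C : {set V}) : bool :=
  [forall u in C, forall v in C, (u != v) ==> (d <= gdist e u v)].

Definition anticode (V : finType) (e : rel V) (r : nat) (D : {set V}) : bool :=
  [forall u in D, forall v in D, gdist e u v <= r].

Definition max_anticode (V : finType) (e : rel V) (r : nat) : nat :=
  \max_(D : {set V} | anticode e r D) #|D|.

Definition diameter_perfect (V : finType) (e : rel V) (r : nat) (C : {set V}) : Prop :=
  min_dist_geq e r.+1 C /\ #|C| * max_anticode e r = #|V|.

Definition power_graph (V : finType) (e : rel V) (r : nat) : rel V :=
  [rel u v | 1 <= gdist e u v <= r].

Definition neighbour (V : finType) (h : rel V) (v : V) : finType :=
  {u : V | h v u}.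

Definition storage_code (V : finType) (h : rel V) (Q : finType)
    (C : {set {ffun V -> Q}}) : Prop :=
  C != finset.set0 /\
  forall v : V, exists f : {ffun neighbour h v -> Q} -> Q,
    forall x, x \in C -> x v = f [ffun u : neighbour h v => x (val u)].

Local Open Scope ring_scope.

Definition code_rate (R : realType) (V Q : finType) (C : {set {ffun V -> Q}}) : R :=
  (#|V|%:R)^-1 * (ln #|C|%:R / ln #|Q|%:R).

Arguments code_rate R {V Q} C.

Definition storage_rates (R : realType) (V : finType) (h : rel V) : set R :=
  [set x : R | exists (Q : finType) (C : {set {ffun V -> Q}}),
     [/\ (2 <= #|Q|)%N, storage_code h C & x = code_rate R C]]%classic.

Arguments storage_rates R {V} h.

Definition capacity (R : realType) (V : finType) (h : rel V) : R :=
  sup (storage_rates R h).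

Arguments capacity R {V} h.

(* [sup] takes a default value on sets that are empty or unbounded above;
   this lemma shows that the default never matters here. *)
Lemma has_sup_storage_rates (R : realType) (V : finType) (h : rel V) :
  has_sup (storage_rates R h).
Proof.
split.
  exists (code_rate R [set [ffun _ : V => true]]), bool, [set [ffun=> true]].
  split; rewrite ?card_bool //; split.
    by apply/set0Pn; exists [ffun=> true]; rewrite inE.
  by move=> v; exists (fun=> true) => x; rewrite inE => /eqP ->; rewrite ffunE.
exists 1 => _ [Q [C [Q2 [C0 _] ->]]]; rewrite /code_rate.
have C1 : (0 < #|C|)%N by rewrite card_gt0.
have lnQ : 0 < ln #|Q|%:R :> R by rewrite ln_gt0 // ltr1n.
have : ln #|C|%:R <= ln #|Q|%:R *+ #|V| :> R.
  rewrite -lnXn ?ltr0n ?(ltn_trans _ Q2) // ler_ln ?posrE ?exprn_gt0 ?ltr0n ?(ltn_trans _ Q2) //.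
  by rewrite -natrX ler_nat -card_ffun max_card.
move=> le; have [->|V0] := posnP #|V|; first by rewrite invr0 mul0r ler01.
by rewrite ler_pdivrMl ?ltr0n // mulr1 ler_pdivrMr // mulr_natl.
Qed.

(* Main.v *)
Require Import Defs.
From mathcomp Require Import all_boot all_order all_algebra all_fingroup.
From mathcomp Require Import reals.
From mathcomp Require Import exp.

(** Upper bound: a diameter perfect code is an independent set of [G_r] of size
    [n / D_G(r)], and a codeword of a storage code is determined by its
    restriction to the complement of an independent set.  Lower bound: the
    translates of a maximum anticode under the automorphism group are cliques of
    [G_r] covering every vertex the same number of times; imposing one binary
    parity check per translate gives a storage code of rate at least
    [1 - 1 / D_G(r)]. *)

Set Implicit Arguments.
Unset Strict Implicit.
Unset Printing Implicit Defensive.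

Import Order.TTheory GRing.Theory Num.Theory.

(** * Distances and anticodes under automorphisms *)

Section Distance.

Variables (V : finType) (e : rel V).

Lemma gdist_eq0 u v : connect e u v -> (gdist e u v == 0%N) = (u == v).
Proof.
move=> uv; have [/existsP[p /andP[_ /eqP pv]] minw] := gdistP uv.
apply/eqP/eqP => [d0|->].
  by rewrite -pv (size0nil (s := p)) // size_tuple.
apply/eqP; rewrite -leqn0.
have [_] := gdistP (connect0 e v); apply.
by apply/existsP; exists [tuple]; rewrite /= eqxx.
Qed.

Lemma has_walk_aut s u v k : s \in graph_aut e ->
  has_walk e (s u) (s v) k = has_walk e u v k.
Proof.
have sub t a b : t \in graph_aut e -> has_walk e a b k -> has_walk e (t a) (t b) k.
  rewrite inE => /forallP tP /existsP[p /andP[pp /eqP pb]].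
  apply/existsP; exists (map_tuple t p); rewrite last_map pb eqxx andbT path_map.
  by rewrite (@eq_path _ _ e) // => x y /=; rewrite (eqP (forallP (tP x) y)).
move=> sA; apply/idP/idP; last exact: sub.
by move=> /(sub _ _ _ (groupVr sA)); rewrite !permK.
Qed.

Lemma gdist_aut s u v : s \in graph_aut e -> gdist e (s u) (s v) = gdist e u v.
Proof. by move=> sA; apply: eq_find => k; apply: has_walk_aut. Qed.

Lemma anticode_preim_aut s r (D : {set V}) : s \in graph_aut e ->
  anticode e r D -> anticode e r (s @^-1: D).
Proof.
move=> sA /forall_inP aD; apply/forall_inP => u; rewrite inE => uD.
apply/forall_inP => v; rewrite inE => vD.
by rewrite -(gdist_aut u v sA); apply: (forall_inP (aD _ uD)).
Qed.

Lemma max_anticode_attained r :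
  exists2 D : {set V}, anticode e r D & #|D| = max_anticode e r.
Proof.
rewrite /max_anticode; have a0 : anticode e r set0 by apply/forall_inP => u; rewrite inE.
have /(eq_bigmax_cond (fun D : {set V} => #|D|)) [D aD ->] :
  (0 < #|[pred D : {set V} | anticode e r D]|)%N by apply/card_gt0P; exists set0.
by exists D.
Qed.

(** If the automorphism [t] sends [u] to [v], then left multiplication by [t^-1] carries the first
    set onto the second. This makes the cover by translates of [D] regular. *)
Lemma card_aut_preim_vertex (D : {set V}) u v : vertex_transitive e ->
  #|[set s in graph_aut e | s u \in D]| = #|[set s in graph_aut e | s v \in D]|.
Proof.
move=> tr; have [t tA /= ->] := atransP2 tr (in_setT u) (in_setT v).
rewrite -(card_imset _ (mulgI t^-1)%g); apply: eq_card => s.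
rewrite [RHS]inE; apply/imsetP/andP => [[s']|[sA sD]].
  rewrite inE => /andP[s'A s'D] ->; split; first by rewrite groupM ?groupV.
  by rewrite permM /= apermE permK.
exists (t * s)%g; last by rewrite mulKg.
by rewrite inE groupM //= permM -apermE.
Qed.

End Distance.

(** * Storage codes and the independent set bound *)

Section StorageCodes.

Variables (V : finType) (h : rel V).

Lemma storage_code_of_determined (Q : finType) (C : {set {ffun V -> Q}}) :
  C != set0 ->
  (forall v x y, x \in C -> y \in C -> (forall u, h v u -> x u = y u) -> x v = y v) ->
  storage_code h C.
Proof.
move=> C0 detC; split=> // v; have /set0Pn[x0 _] := C0.
pose res (x : {ffun V -> Q}) := [ffun u : neighbour h v => x (val u)].
(* Recovery picks any codeword with the observed neighbourhood; all of them agree at [v]. The value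
   [x0 v] only fills in patterns that no codeword shows. *)
exists (fun z => if [pick x in C | res x == z] is Some x then x v else x0 v) => x xC.
case: pickP => [y /andP[yC /eqP yx]|/(_ x)]; last by rewrite /= xC eqxx.
apply: detC => // u hu.
by have /ffunP/(_ (Sub u hu)) := yx; rewrite !ffunE /=.
Qed.

(** The case [u = v] is included, so loops are excluded as well and every neighbour of a vertex of
    [S] lies outside [S]. *)
Definition independent (S : {set V}) := forall u v, u \in S -> v \in S -> ~~ h u v.

Lemma card_storage_code_le (Q : finType) (C : {set {ffun V -> Q}}) (S : {set V}) :
  storage_code h C -> independent S -> (#|C| <= #|Q| ^ #|~: S|)%N.
Proof.
move=> [_ sC] indS.
pose res (x : {ffun V -> Q}) := [ffun u : {u | u \in ~: S} => x (val u)].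
have res_inj : {in C &, injective res}.
  move=> x y xC yC /ffunP xy.
  have out u : u \notin S -> x u = y u.
    by move=> uS; have := xy (Sub u (etrans (in_setC u S) uS)); rewrite !ffunE.
  apply/ffunP => v; have [vS|] := boolP (v \in S); last exact: out.
  have [f fP] := sC v; rewrite !fP //; congr f; apply/ffunP => u; rewrite !ffunE.
  by apply: out; apply: contraL (valP u) => uS; apply: indS.
rewrite -(card_in_imset res_inj) -[#|~: S|]card_sig -card_ffun; exact: max_card.
Qed.

Lemma capacity_le_independent (R : realType) (S : {set V}) :
  (0 < #|V|)%N -> independent S ->
  (capacity R h <= 1 - #|S|%:R / #|V|%:R)%R.
Proof.
move=> V0 indS; apply: ge_sup; first by have [] := has_sup_storage_rates R h.
move=> _ [Q [C [Q2 sC ->]]]; rewrite /code_rate.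
have V0R : (0 < #|V|%:R :> R)%R by rewrite ltr0n.
have lnQ : (0 < ln #|Q|%:R :> R)%R by rewrite ln_gt0 // ltr1n.
have Q0 : (0 < #|Q|)%N by apply: leq_trans Q2.
rewrite ler_pdivrMl // mulrBr mulr1 mulrCA divff ?gt_eqF // mulr1 ler_pdivrMr //.
rewrite -natrB ?max_card // -(cardsC S) addKn mulr_natl -lnXn ?ltr0n //.
by rewrite -natrX ler_ln ?posrE ?ltr0n ?expn_gt0 ?Q0 // ?ler_nat;
  [apply: card_storage_code_le | rewrite card_gt0; case: sC].
Qed.

End StorageCodes.

(** * Parity codes from a regular clique cover *)

Section CliqueCover.

Local Open Scope ring_scope.

Variables (V I : finType) (h : rel V) (K : I -> {set V}) (m : nat).
Hypothesis clique : forall i u v, u \in K i -> v \in K i -> u != v -> h u v.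
Hypothesis regular : forall v, #|[set i | v \in K i]| = m.

(** Numbers the [m] cliques through [v], so that the symbol at [v] can carry one bit for each of
    them. *)
Let block v (j : 'I_m) : I := enum_val (cast_ord (esym (regular v)) j).

Let block_inj v : injective (block v).
Proof. by move=> j k /enum_val_inj /cast_ord_inj. Qed.

Let mem_block v j : v \in K (block v j).
Proof. by have := enum_valP (cast_ord (esym (regular v)) j); rewrite inE. Qed.

Let word := {ffun V -> {ffun 'I_m -> 'F_2}}.

Let syndrome (x : word) : {ffun I -> 'F_2} :=
  [ffun i => \sum_v \sum_(j | block v j == i) x v j].

Let syndromeB x y : syndrome (x - y) = syndrome x - syndrome y.
Proof.
apply/ffunP => i; rewrite !ffunE -sumrB; apply: eq_bigr => v _.
by rewrite -sumrB; apply: eq_bigr => j _; rewrite !ffunE.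
Qed.

Definition parity_code : {set word} := [set x | syndrome x == 0].

(** Bit [j] at [v] enters only the check of [block v j], and by injectivity of [block v] it is the
    only bit of [v] there. The other bits of that check sit at members of the same clique, hence at
    neighbours of [v], and determine it. *)
Lemma parity_code_storage : storage_code h parity_code.
Proof.
apply: storage_code_of_determined.
  by apply/set0Pn; exists 0; rewrite inE -(subrr 0) syndromeB subrr.
move=> v x y; rewrite !inE => /eqP/ffunP xC /eqP/ffunP yC xy; apply/ffunP => j.
have := etrans (xC (block v j)) (esym (yC (block v j))).
have only (z : word) : \sum_(k | block v k == block v j) z v k = z v j.
  by rewrite (big_pred1 j) // => k; rewrite /= (inj_eq (@block_inj v)).
rewrite !ffunE (bigD1 v) //= [RHS](bigD1 v) //= !only.
under eq_bigr => u uv.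
  under eq_bigr => k /eqP bk.
    rewrite xy; last first.
      by apply: (clique (mem_block v j)); rewrite 1?eq_sym // -bk mem_block.
    over.
  over.
exact: addIr.
Qed.

(* The fibres of the syndrome map are empty or translates of the code. *)
Lemma card_parity_code : (2 ^ (m * #|V|) <= #|parity_code| * 2 ^ #|I|)%N.
Proof.
have -> : (2 ^ (m * #|V|))%N = #|{: word}|.
  by rewrite !card_ffun card_Fp // card_ord expnM.
have -> : (2 ^ #|I|)%N = #|{: {ffun I -> 'F_2}}| by rewrite card_ffun card_Fp.
rewrite -[#|{: word}|]sum1_card (partition_big syndrome predT) //= mulnC -sum_nat_const.
apply: leq_sum => s _; rewrite sum1_card.
have [->//|/card_gt0P[x0 /(eqP (y := s)) x0s]] := posnP #|[pred x | syndrome x == s]|.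
rewrite -(card_imset _ (addIr (- x0))); apply/subset_leq_card/subsetP.
move=> _ /imsetP[x /(eqP (y := s)) xs ->].
by rewrite inE syndromeB xs x0s subrr.
Qed.

(** The parity code has at least [m * #|V| - #|I|] information bits, and the alphabet has [2 ^ m]
    letters; dividing by [m * #|V|] gives the rate. *)
Lemma capacity_ge_cover (R : realType) : (0 < #|V|)%N -> (0 < m)%N ->
  1 - #|I|%:R / (m * #|V|)%:R <= capacity R h.
Proof.
move=> V0 m0; have sC := parity_code_storage.
have cQ : #|{ffun 'I_m -> 'F_2}| = (2 ^ m)%N by rewrite card_ffun card_Fp // card_ord.
have C0 : (0 < #|parity_code|)%N by rewrite card_gt0; case: sC.
have ln2 : 0 < ln 2 :> R by rewrite ln_gt0 // ltr1n.
have V0R : 0 < #|V|%:R :> R by rewrite ltr0n.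
have m0R : 0 < m%:R :> R by rewrite ltr0n.
have rateC : storage_rates R h (code_rate R parity_code).
  exists {ffun 'I_m -> 'F_2}, parity_code; split=> //.
  by rewrite cQ -[X in (X <= _)%N]expn1 leq_exp2l.
apply: le_trans (ub_le_sup (proj2 (has_sup_storage_rates R h)) rateC).
have : (m * #|V|)%:R * ln 2 <= ln #|parity_code|%:R + #|I|%:R * ln 2 :> R.
  rewrite !mulr_natl -!lnXn // -lnM ?posrE ?exprn_gt0 ?ltr0n //.
  by rewrite -!natrX -natrM ler_ln ?posrE ?ltr0n ?muln_gt0 ?C0 ?expn_gt0 // ler_nat
             card_parity_code.
rewrite /code_rate cQ natrX lnXn // -lerBlDr -mulrBl -[_ *+ m]mulr_natl => le.
have N0 : 0 < (m * #|V|)%:R :> R by rewrite ltr0n muln_gt0 m0.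
rewrite mulrCA -invfM mulrA -natrM [(_ * m)%N]mulnC ler_pdivlMr ?mulr_gt0 //.
by rewrite mulrA mulrBl mul1r divfK ?gt_eqF.
Qed.

End CliqueCover.

(** * The two bounds for a diameter perfect code *)

Local Open Scope ring_scope.

Theorem theorem2p2 (R : realType) (V : finType) (e : rel V) (r : nat)
    (e_simple : simple_graph e) (e_connected : connected_graph e)
    (r_ge1 : (1 <= r)%N)
    (e_transitive : vertex_transitive e)
    (e_perfect : exists C : {set V}, diameter_perfect e r C) :
  capacity R (power_graph e r) = 1 - 1 / (max_anticode e r)%:R.
Proof.
have [V0 conn] := e_connected; have [C [Cdist Ccard]] := e_perfect.
have V0R : #|V|%:R != 0 :> R by rewrite pnatr_eq0 -lt0n.
have [C0 M0] : (0 < #|C|)%N /\ (0 < max_anticode e r)%N.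
  by apply/andP; rewrite -muln_gt0 Ccard.
apply/eqP; rewrite eq_le; apply/andP; split.
  (* Perfection turns the target into the independent set bound for [C]. *)
  have -> : 1 / (max_anticode e r)%:R = #|C|%:R / #|V|%:R :> R.
    by rewrite -Ccard natrM invfM div1r mulVKf // pnatr_eq0 -lt0n.
  apply: capacity_le_independent => // u v uC vC; rewrite /power_graph /=.
  have [->|uv] := eqVneq u v; first by rewrite lt0n gdist_eq0 ?eqxx.
  have := implyP (forall_inP (forall_inP Cdist u uC) v vC) uv.
  by rewrite ltnNge => /negbTE ->; rewrite andbF.
have [D aD cardD] := max_anticode_attained e r.
(* Indexing by automorphisms counts coinciding translates with multiplicity. With preimages, [v]
   lies in the translate of [s] exactly when [s v] lies in [D]. *)
pose I : finType := {s : {perm V} | s \in graph_aut e}.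
pose K (i : I) : {set V} := val i @^-1: D.
have [v0 _] := card_gt0P V0.
pose m := #|[set i | v0 \in K i]|.
have card_fiber v : #|[set i | v \in K i]| = #|[set s in graph_aut e | s v \in D]|.
  rewrite -(card_imset _ val_inj); apply: eq_card => s; rewrite [RHS]inE.
  apply/imsetP/andP => [[i iK ->] | [sA sD]].
    by split; [exact: valP i | move: iK; rewrite !inE].
  by exists (Sub s sA : I); rewrite ?inE SubK.
have regular v : #|[set i | v \in K i]| = m.
  by rewrite /m !card_fiber; apply: card_aut_preim_vertex.
have clique i u v : u \in K i -> v \in K i -> u != v -> power_graph e r u v.
  move=> uK vK uv; rewrite /power_graph /= lt0n gdist_eq0 // uv /=.
  exact: forall_inP (forall_inP (anticode_preim_aut (valP i) aD) u uK) v vK.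
(* Incidences between vertices and translates: [m] at each vertex, and [#|D|] in each translate
   since automorphisms are bijective. *)
have double_count : (m * #|V| = #|I| * max_anticode e r)%N.
  have -> : (m * #|V| = \sum_v \sum_i (v \in K i))%N.
    rewrite mulnC -sum_nat_const; apply: eq_bigr => v _.
    by rewrite -(regular v) -sum1dep_card big_mkcond.
  rewrite exchange_big -sum_nat_const; apply: eq_bigr => i _ /=.
  rewrite -cardD -(on_card_preimset (f := val i) (R := D)); last first.
    by apply: onW_bij; exists (val i)^-1%g; [apply: permK | apply: permKV].
  by rewrite -sum1_card [RHS]big_mkcond.
have I0 : (0 < #|I|)%N by rewrite card_sig; apply/card_gt0P; exists 1%g; apply: group1.
have m0 : (0 < m)%N.
  by have : (0 < m * #|V|)%N by [rewrite double_count muln_gt0 I0]; rewrite muln_gt0 => /andP[].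
apply: le_trans (capacity_ge_cover clique regular R V0 m0).
by rewrite double_count natrM invfM mulVKf ?div1r // pnatr_eq0 -lt0n.
Qed.
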